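(* Let $X$ be a normal modal logic and let $I$ be an index set with $\omega\subseteq I$. Suppose that $X$ is complete with respect to a set of Kripke frames $F=\{(G_\alpha,R_\alpha):\alpha\in I\}$, where for every $\alpha\in I$, $G_\alpha$ is a nonempty infinite set and $R_\alpha$ is an accessibility relation (a binary relation) on $G_\alpha$. Let $H=\{(G_i^*,R_i^* ): i\in\omega\}$ be a set of Kripke frames such that for every $i\in\omega$: $$G_i^*=\{*,g_0,g_1,\dots,g_i\}\cup G_{\omega i},$$ where $G_{\omega i}=\{\eta_{ij}: j\in\omega\}$ has cardinality $\aleph_0$, $\{*,g_0,\dots,g_i\}\cap G_{\omega i}=\emptyset$, the elements $*,g_0,\dots,g_i$ are distinct, and $$R_i^*=\{( *,g_j):0\le j\le i\}\cup\{(g_j,g_k): j\ne k,\ 1\le j\le i,\ 1\le k\le i\}\cup\{(\eta,\eta):\eta\in G_{\omega i}\}.$$ If $H\subseteq F$, then $B$-translation is faithful with respect to $X$.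
   Context: The system $\mathbf{L_1}$ (Leśniewski's propositional ontology): fix a countably infinite set of name variables. The atomic formulas are exactly the expressions $\epsilon ab$ with $a,b$ name variables (possibly equal); formulas are built from atomic formulas by $\vee$ and $\neg$, the other connectives being the usual classical abbreviations. $\mathbf{L_1}$ is a Hilbert-style system of classical propositional logic (with modus ponens) over these formulas with the additional axiom schemata, for all name variables $a,b,c$: (Ax1) $\epsilon ab \supset \epsilon aa$; (Ax2) $(\epsilon ab \wedge \epsilon bc) \supset \epsilon ac$; (Ax3) $(\epsilon ab \wedge \epsilon bc) \supset \epsilon ba$. $B$-translation: to each name variable $a$ corresponds a propositional variable $p_a$, with distinct name variables corresponding to distinct propositional variables. $B$ maps formulas of $\mathbf{L_1}$ to propositional modal formulas by $B(\phi\vee\psi)=B(\phi)\vee B(\psi)$, $B(\neg\phi)=\neg B(\phi)$, $B(\epsilon ab)=p_a\wedge\Box(p_a\supset p_b)\wedge\bigl(p_b\supset\Box(p_b\supset p_a)\bigr)$. $B$-translation is faithful with respect to a modal logic $X$ if for every formula $\phi$ of $\mathbf{L_1}$, $\vdash_X B(\phi)$ implies $\vdash_{\mathbf{L_1}}\phi$. A normal modal logic is a set $X$ of propositional modal formulas with $\mathbf{K}\subseteq X$ that is closed under modus ponens, substitution and necessitation. $X$ is complete with respect to a set $F$ of Kripke frames if, for every modal formula $\chi$, $\vdash_X\chi$ holds if and only if $\chi$ is valid in every frame in $F$. *)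

(* Defs.v *)
From mathcomp Require Import all_boot all_classical.

Set Implicit Arguments.
Unset Strict Implicit.
Unset Printing Implicit Defensive.

Local Open Scope classical_set_scope.

(* The Hilbert-Ackermann schemata, complete for classical propositional logic
   together with modus ponens when disjunction and negation are primitive;
   [A ⊃ B] abbreviates [¬A ∨ B].  They are shared by the two languages below. *)
Inductive prop_axiom (form : Type) (neg : form -> form)
    (or : form -> form -> form) : form -> Prop :=
| PA_idem A : prop_axiom neg or (or (neg (or A A)) A)
| PA_weak A B : prop_axiom neg or (or (neg A) (or A B))
| PA_comm A B : prop_axiom neg or (or (neg (or A B)) (or B A))
| PA_mono A B C :
    prop_axiom neg or
      (or (neg (or (neg B) C)) (or (neg (or A B)) (or A C))).

(* Name variables are natural numbers; [LEps a b] is the atom [ε a b]. *)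

Inductive lform : Type :=
| LEps of nat & nat
| LNeg of lform
| LOr of lform & lform.

Definition LImp (A B : lform) : lform := LOr (LNeg A) B.
Definition LAnd (A B : lform) : lform := LNeg (LOr (LNeg A) (LNeg B)).

Inductive L1_provable : lform -> Prop :=
| L1_prop A : prop_axiom LNeg LOr A -> L1_provable A
| L1_Ax1 a b : L1_provable (LImp (LEps a b) (LEps a a))
| L1_Ax2 a b c :
    L1_provable (LImp (LAnd (LEps a b) (LEps b c)) (LEps a c))
| L1_Ax3 a b c :
    L1_provable (LImp (LAnd (LEps a b) (LEps b c)) (LEps b a))
| L1_mp A B : L1_provable (LImp A B) -> L1_provable A -> L1_provable B.

Inductive mform : Type :=
| MVar of nat
| MNeg of mform
| MOr of mform & mform
| MBox of mform.

Definition MImp (A B : mform) : mform := MOr (MNeg A) B.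
Definition MAnd (A B : mform) : mform := MNeg (MOr (MNeg A) (MNeg B)).

Fixpoint msubst (s : nat -> mform) (A : mform) : mform :=
  match A with
  | MVar n => s n
  | MNeg A => MNeg (msubst s A)
  | MOr A B => MOr (msubst s A) (msubst s B)
  | MBox A => MBox (msubst s A)
  end.

(* All axioms are schemata, so closure under substitution is admissible. *)
Inductive logicK : set mform :=
| K_prop A : prop_axiom MNeg MOr A -> logicK A
| K_dist A B : logicK (MImp (MBox (MImp A B)) (MImp (MBox A) (MBox B)))
| K_mp A B : logicK (MImp A B) -> logicK A -> logicK B
| K_nec A : logicK A -> logicK (MBox A).

Record normal_modal_logic (X : set mform) : Prop := NormalModalLogic {
  normal_K : logicK `<=` X;
  normal_mp : forall A B, X (MImp A B) -> X A -> X B;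
  normal_subst : forall s A, X A -> X (msubst s A);
  normal_nec : forall A, X A -> X (MBox A)
}.

Record frame : Type := Frame {
  world :> Type;
  access : world -> world -> Prop
}.

Fixpoint sat (G : frame) (V : nat -> set G) (w : G) (A : mform) : Prop :=
  match A with
  | MVar n => V n w
  | MNeg A => ~ sat V w A
  | MOr A B => sat V w A \/ sat V w B
  | MBox A => forall v : G, access w v -> sat V v A
  end.

Definition valid (G : frame) (A : mform) : Prop :=
  forall (V : nat -> set G) (w : G), sat V w A.

Definition complete_wrt (X : set mform) (I : Type) (F : I -> frame) : Prop :=
  forall A : mform, X A <-> forall i : I, valid (F i) A.

(* [p] is the correspondence from name variables to propositional variables. *)

Fixpoint Btrans (p : nat -> nat) (A : lform) : mform :=
  match A with
  | LEps a b =>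
      let pa := MVar (p a) in
      let pb := MVar (p b) in
      MAnd (MAnd pa (MBox (MImp pa pb))) (MImp pb (MBox (MImp pb pa)))
  | LNeg A => MNeg (Btrans p A)
  | LOr A B => MOr (Btrans p A) (Btrans p B)
  end.

Definition B_faithful (p : nat -> nat) (X : set mform) : Prop :=
  forall A : lform, X (Btrans p A) -> L1_provable A.

(* [star_frame i G]: up to the naming of its points, [G] is the frame of
   index [i] of the family H.  In the last clause the bounds [j <= i] and
   [k <= i] are carried by the type ['I_i.+1].  The enumeration [eta] may have
   repetitions; it is its range that is countably infinite. *)

Definition star_frame (i : nat) (G : frame) : Prop :=
  exists (star : G) (g : 'I_i.+1 -> G) (eta : nat -> G),
    [/\ [set: G] = ([set star] `|` range g) `|` range eta,
        (range eta #= [set: nat])%card,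
        ([set star] `|` range g) `&` range eta = set0,
        injective g /\ ~ range g star
      & forall x y : G, access x y <->
          [\/ exists j : 'I_i.+1, x = star /\ y = g j,
              exists j k : 'I_i.+1,
                [/\ j <> k, (1 <= j)%N, (1 <= k)%N, x = g j & y = g k]
            | exists n : nat, x = eta n /\ y = eta n]].

(* Main.v *)
(* Contrapositive.  Order formulas by provable implication, so that [LOr] is
   the join.  An unprovable formula can be enlarged to an unprovable [D] that
   decides each of the finitely many atoms [ε a b] of the formula.  Put
   [e a b := ⊢ ε a b ∨ D]; this relation obeys Ax1-Ax3.  In a star frame whose
   points [g_c] are indexed by name variables [c <= N], let [p_a] hold at [*]
   iff [e a a], and at [g_c] iff [e c a].  Then [B(ε a b)] holds at [*] iff
   [e a b], since [B(ε a b)] only looks at [*] and its successors [g_c]; hence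
   the translation of the unprovable formula fails at [*]. *)
Require Import Defs.
From mathcomp Require Import all_boot all_classical.

Local Open Scope classical_set_scope.

Local Notation "|- A" := (L1_provable A) (at level 70).
Local Notation "A <=L B" := (L1_provable (LImp A B)) (at level 70).

(** [LImp A _] is a disjunction with left disjunct [LNeg A], so [PA_mono] prefixes [A] to
    [B <=L C]. *)
Lemma le_trans A B C : A <=L B -> B <=L C -> A <=L C.
Proof.
by move=> AB BC; apply: L1_mp AB; apply: L1_mp BC; apply/L1_prop/PA_mono.
Qed.

Lemma le_orl A B : A <=L LOr A B.
Proof. exact/L1_prop/PA_weak. Qed.

Lemma le_orC A B : LOr A B <=L LOr B A.
Proof. exact/L1_prop/PA_comm. Qed.

Lemma le_orr A B : B <=L LOr A B.
Proof. exact: le_trans (le_orl _ _) (le_orC _ _). Qed.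

Lemma le_refl A : A <=L A.
Proof. by apply: le_trans (le_orl A A) _; apply/L1_prop/PA_idem. Qed.

Lemma or_le A B C : A <=L C -> B <=L C -> LOr A B <=L C.
Proof.
move=> AC BC; apply: (@le_trans _ (LOr A C)).
  by apply: L1_mp BC; apply/L1_prop/PA_mono.
apply: le_trans (le_orC _ _) _; apply: (@le_trans _ (LOr C C)).
  by apply: L1_mp AC; apply/L1_prop/PA_mono.
exact/L1_prop/PA_idem.
Qed.

Lemma or_mono A A' B B' : A <=L A' -> B <=L B' -> LOr A B <=L LOr A' B'.
Proof.
move=> AA' BB'; apply: or_le; first exact: le_trans AA' (le_orl _ _).
exact: le_trans BB' (le_orr _ _).
Qed.

Lemma or_rotate A B C : LOr (LOr A B) C <=L LOr A (LOr B C).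
Proof.
apply: or_le; first by apply: or_mono (le_refl _) (le_orl _ _).
exact: le_trans (le_orr B C) (le_orr _ _).
Qed.

(** Reflexivity at [LNeg A] is a disjunction; commuting it gives the claim. *)
Lemma le_negK A : A <=L LNeg (LNeg A).
Proof. exact: L1_mp (le_orC _ _) (le_refl _). Qed.

Lemma negK_le A : LNeg (LNeg A) <=L A.
Proof.
exact: L1_mp (or_mono _ _ _ _ (le_negK _) (le_refl _)) (le_refl A).
Qed.

Lemma provable_or_le A B D : A <=L LOr B D -> |- LOr A D -> |- LOr B D.
Proof. by move=> AB; apply/L1_mp/or_le => //; apply: le_orr. Qed.

(** Currying: without its double negation the hypothesis reads [A <=L LImp B C]. Then [A] and [B]
    are cut one after the other, with [D] as side formula. This carries Ax2 and Ax3 over to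
    provability modulo [D]. *)
Lemma provable_or_and A B C D :
  LAnd A B <=L C -> |- LOr A D -> |- LOr B D -> |- LOr C D.
Proof.
move=> ABC AD BD; apply: provable_or_le BD; apply: L1_mp (or_rotate _ _ _) _.
apply: provable_or_le AD; apply: le_trans (le_orl _ D).
apply: L1_mp (or_rotate _ _ _) _.
exact: L1_mp (or_mono _ _ _ _ (negK_le _) (le_refl _)) ABC.
Qed.

Fixpoint all_atoms (P : nat -> nat -> Prop) (A : lform) : Prop :=
  match A with
  | LEps a b => P a b
  | LNeg A => all_atoms P A
  | LOr A B => all_atoms P A /\ all_atoms P B
  end.

Lemma all_atoms_sub (P Q : nat -> nat -> Prop) A :
  (forall a b, P a b -> Q a b) -> all_atoms P A -> all_atoms Q A.
Proof.
by move=> PQ; elim: A => [a b|A IHA|A IHA B IHB] //=; [exact: PQ|case=> /IHA ? /IHB].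
Qed.

Lemma all_atoms_bound A :
  exists N, all_atoms (fun a b => (a <= N)%N /\ (b <= N)%N) A.
Proof.
elim: A => [a b||A [M AM] B [N BN]] //=.
  by exists (maxn a b); rewrite leq_maxl leq_maxr.
exists (maxn M N); split.
  by apply: all_atoms_sub AM => a b [aM bM]; rewrite !leq_max aM bM.
by apply: all_atoms_sub BN => a b [aN bN]; rewrite !leq_max aN bN !orbT.
Qed.

(** With [D] collapsed to bottom, [A] becomes top or bottom. *)
Definition decides (D A : lform) : Prop := |- LOr A D \/ A <=L D.

Lemma decides_le D D' A : D <=L D' -> decides D A -> decides D' A.
Proof.
move=> DD' [AD|AD]; [left|right; exact: le_trans AD DD'].
exact: L1_mp (or_mono _ _ _ _ (le_refl _) DD') AD.
Qed.

(** If [LOr A D] is unprovable, it is itself the extension, since it lies above [A]. *)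
Lemma extend_deciding D A : ~ |- D ->
  exists D', [/\ D <=L D', ~ |- D' & decides D' A].
Proof.
move=> nD; have [AD|nAD] := EM (|- LOr A D).
  by exists D; split => //; [exact: le_refl|left].
by exists (LOr A D); split => //; [exact: le_orr|right; exact: le_orl].
Qed.

(** Atoms are treated one at a time; by [decides_le] a decision survives every later enlargement. *)
Lemma extend_deciding_atoms A D : ~ |- D ->
  exists D', [/\ D <=L D', ~ |- D' &
    all_atoms (fun a b => decides D' (LEps a b)) A].
Proof.
elim: A D => [a b D|//|A IHA B IHB D /IHA[D1 [DD1 nD1 AD1]]].
  exact: extend_deciding.
have [D2 [D12 nD2 BD2]] := IHB _ nD1.
exists D2; split=> //; first exact: le_trans DD1 D12.
by split=> //; apply: all_atoms_sub AD1 => a b; apply: decides_le.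
Qed.

Definition holds_mod (D : lform) (a b : nat) : Prop := |- LOr (LEps a b) D.

Lemma holds_modxx D a b : holds_mod D a b -> holds_mod D a a.
Proof.
by apply: provable_or_le; apply: le_trans (le_orl _ _); apply: L1_Ax1.
Qed.

Lemma holds_mod_trans D a b c :
  holds_mod D a b -> holds_mod D b c -> holds_mod D a c.
Proof. exact/provable_or_and/L1_Ax2. Qed.

Lemma holds_mod_sym D a b c :
  holds_mod D a b -> holds_mod D b c -> holds_mod D b a.
Proof. exact/provable_or_and/L1_Ax3. Qed.

Lemma sat_and (G : frame) (V : nat -> set G) (w : G) A B :
  sat V w (MAnd A B) <-> sat V w A /\ sat V w B.
Proof. by rewrite /= not_orP !notK. Qed.

Lemma sat_imp (G : frame) (V : nat -> set G) (w : G) A B :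
  sat V w (MImp A B) <-> (sat V w A -> sat V w B).
Proof. by rewrite /= implyE. Qed.

Lemma sat_eps (p : nat -> nat) (G : frame) (V : nat -> set G) (w : G) a b :
  sat V w (Btrans p (LEps a b)) <->
  [/\ V (p a) w, forall v, access w v -> V (p a) v -> V (p b) v &
      V (p b) w -> forall v, access w v -> V (p b) v -> V (p a) v].
Proof.
rewrite [Btrans _ _]/=; split.
  move=> /sat_and[/sat_and[aw ab] /sat_imp ba]; split=> // [v wv|bw v wv].
    exact: (sat_imp _ _ _ (MVar _) (MVar _)).1 (ab v wv).
  exact: (sat_imp _ _ _ (MVar _) (MVar _)).1 (ba bw v wv).
move=> [aw ab ba]; apply/sat_and; split.
  by apply/sat_and; split=> // v wv; apply/(sat_imp _ _ _ (MVar _) (MVar _))/ab.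
by apply/sat_imp => bw v wv; apply/(sat_imp _ _ _ (MVar _) (MVar _))/ba.
Qed.

(** Only the first kind of edge can leave [star]: the second would put it in [range g], the third in
    [range eta]. *)
Lemma star_frame_access i (G : frame) : star_frame i G ->
  exists (star : G) (g : 'I_i.+1 -> G), [/\ injective g, ~ range g star &
    forall y, access star y <-> range g y].
Proof.
move=> [star [g [eta [_ _ disj [g_inj ng] acc]]]]; exists star, g.
split=> // y; split=> [/acc[[j [_ ->]]|[j [k [_ _ _ e _]]]|[n [e _]]]|].
- by exists j.
- by case: ng; exists j.
- have : (([set star] `|` range g) `&` range eta) star.
    by split; [left|exists n].
  by rewrite disj.
- by move=> [j _ <-]; apply/acc; constructor 1; exists j.
Qed.

Section StarValuation.

Context (p : nat -> nat) (p_inj : injective p) (D : lform).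
Context (G : frame) (N : nat) (star : G) (g : 'I_N.+1 -> G).
Context (g_inj : injective g) (star_notin : ~ range g star).
Context (access_star : forall y, access star y <-> range g y).

(** Propositional variables outside the range of [p] are false everywhere; for the others
    injectivity of [p] recovers the name variable. *)
Definition star_val (n : nat) : set G := fun w =>
  exists2 a, n = p a & (w = star /\ holds_mod D a a) \/
                       exists2 c : 'I_N.+1, w = g c & holds_mod D c a.

Lemma star_val_star a : star_val (p a) star <-> holds_mod D a a.
Proof.
split=> [[b /p_inj <- [[]//|[c gc _]]]|aa]; last by exists a => //; left.
by case: star_notin; exists c.
Qed.

Lemma star_val_g a c : star_val (p a) (g c) <-> holds_mod D c a.
Proof.
split=> [[b /p_inj <- [[gc _]|[d /g_inj <-//]]]|ca].
  by case: star_notin; exists c.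
by exists a => //; right; exists c.
Qed.

Lemma sat_star_eps a b : (a <= N)%N ->
  sat star_val star (Btrans p (LEps a b)) <-> holds_mod D a b.
Proof.
move=> aN; split=> [/sat_eps[/star_val_star aa ab _]|ab].
  (* At the successor indexed by [a] itself, [p a] holds because [holds_mod D a a]; so [p b] holds
     there, which says [holds_mod D a b]. *)
  pose c : 'I_N.+1 := Ordinal (aN : (a < N.+1)%N).
  have /ab : access star (g c) by apply/access_star; exists c.
  by move=> /(_ ((star_val_g a c).2 aa)) /star_val_g.
apply/sat_eps; split; first exact/star_val_star/holds_modxx/ab.
  move=> _ /access_star[c _ <-] /star_val_g ca.
  exact/star_val_g/holds_mod_trans/ab.
(* Ax3 turns [ab] and [bb] into [holds_mod D b a]; Ax2 then leads from [c] through [b] to [a]. *)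
move=> /star_val_star bb _ /access_star[c _ <-] /star_val_g cb.
exact/star_val_g/(holds_mod_trans _ _ _ _ cb)/holds_mod_sym/bb.
Qed.

(** Both halves are proved together because negation exchanges them: [A <=L D] is literally
    [|- LOr (LNeg A) D]. At a false atom the second half comes from [decides]. *)
Lemma sat_star_provable A :
  all_atoms (fun a b => (a <= N)%N /\ (b <= N)%N) A ->
  all_atoms (fun a b => decides D (LEps a b)) A ->
  (sat star_val star (Btrans p A) -> |- LOr A D) /\
  (~ sat star_val star (Btrans p A) -> A <=L D).
Proof.
elim: A => [a b [aN _] dec|A IHA|A IHA B IHB [AN BN] [Adec Bdec]].
- split=> [/sat_star_eps|nab]; first exact.
  by case: dec => // ab; case: nab; apply/sat_star_eps.
- move=> AN Adec; have [At Af] := IHA AN Adec; split=> /= [/Af//|/contrapT/At].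
  by apply: L1_mp; apply: or_mono (le_negK _) (le_refl _).
have [[At Af] [Bt Bf]] := (IHA AN Adec, IHB BN Bdec); split=> /=.
  by move=> [/At|/Bt]; apply: L1_mp; apply: or_mono (le_refl _);
    [exact: le_orl|exact: le_orr].
by move=> /not_orP[/Af AD /Bf BD]; apply: or_le.
Qed.

End StarValuation.

Theorem theorem7p1 (p : nat -> nat) (p_inj : injective p)
    (X : set mform) (X_normal : normal_modal_logic X)
    (I : Type) (omega_I : nat -> I) (omega_I_inj : injective omega_I)
    (F : I -> frame)
    (F_nonempty : forall alpha : I, [set: F alpha] !=set0)
    (F_infinite : forall alpha : I, infinite_set [set: F alpha])
    (X_complete : complete_wrt X F)
    (H : nat -> frame)
    (H_star : forall i : nat, star_frame i (H i))
    (H_sub_F : range H `<=` range F) :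
  B_faithful p X.
Proof.
move=> A /X_complete valA; apply: contrapT => nA.
(* The enlargement starts from [A] itself, so that [A <=L D] and a proof of [LOr A D] would yield
   [D]. *)
have [D [AD nD decA]] := extend_deciding_atoms A A nA.
have [N AN] := all_atoms_bound A.
(* Index [N] provides one successor of [star] for each name variable up to [N]. *)
have [star [g [g_inj ng acc]]] := star_frame_access _ _ (H_star N).
have [alpha _ FH] : range F (H N) by apply: H_sub_F; exists N.
have := valA alpha; rewrite FH => /(_ (star_val p D _ _ star g) star).
move=> /(sat_star_provable _ p_inj _ _ _ _ _ g_inj ng acc _ AN decA).1.
by move=> AorD; apply: nD; apply: L1_mp AorD; apply: or_le AD (le_refl _).
Qed.
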